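(* Any $CLCD$-consistent formula is satisfied in a finite pseudomodel.
   Context: Let $N$ be a finite set of agents and $\Theta$ a set of atomic propositions. CLCD-formulas: $\phi ::= p \mid \neg\phi \mid \phi\wedge\phi \mid [H]\phi \mid K_i\phi \mid C_G\phi \mid D_G\phi$ ($H\subseteq N$, $\emptyset\neq G\subseteq N$); $E_G\phi$ abbreviates $\bigwedge_{i\in G}K_i\phi$. $CLCD$ is the axiomatisation: classical propositional logic; G1 $\neg[G]\bot$; G2 $[G]\top$; G3 $\neg[\emptyset]\neg\phi\rightarrow[N]\phi$; G4 $[G](\phi\wedge\psi)\rightarrow[G]\psi$; G5 $[G_1]\phi\wedge[G_2]\psi\rightarrow[G_1\cup G_2](\phi\wedge\psi)$ if $G_1\cap G_2=\emptyset$; MP; RG (from $\phi\leftrightarrow\psi$ infer $[G]\phi\leftrightarrow[G]\psi$); K, T, 4, 5 and RN for each $K_i$; C1 $E_G\phi\leftrightarrow\bigwedge_{i\in G}K_i\phi$; C2 $C_G\phi\rightarrow E_G(\phi\wedge C_G\phi)$; RC (from $\phi\rightarrow E_G(\phi\wedge\psi)$ infer $\phi\rightarrow C_G\psi$); the K, T, 4, 5 axioms for each $D_G$; $K_i\phi\leftrightarrow D_{\{i\}}\phi$; $D_G\phi\rightarrow D_H\phi$ if $G\subseteq H$. A pseudomodel is $(S,\{\sim_i\},\{R_G:\emptyset\neq G\subseteq N\},E,V)$ with $S$ non-empty, $V$ a valuation, $\sim_i$ equivalence relations, each $R_G$ an equivalence relation, $R_{\{i\}}=\sim_i$, $G\subseteq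 H\Rightarrow R_H\subseteq R_G$, and $E(G)(s)\subseteq 2^S$ truly playable: (E1) $\emptyset\notin E(G)(s)$; (E2) $S\in E(G)(s)$; (E3) $S\setminus X\notin E(\emptyset)(s)\Rightarrow X\in E(N)(s)$; (E4) upward closure; (E5) $X\in E(G_1)(s)$, $Y\in E(G_2)(s)$, $G_1\cap G_2=\emptyset$ imply $X\cap Y\in E(G_1\cup G_2)(s)$; (E6) the set of $\subseteq$-minimal elements of $E(\emptyset)(s)$ is non-empty. Truth: $[G]\phi$ iff $\{t:\phi \text{ true at } t\}\in E(G)(s)$; $K_i\phi$ via $\sim_i$; $C_G\phi$ via $(\bigcup_{i\in G}\sim_i)^*$; $D_G\phi$ via $R_G$. *)

(* Defs.v *)
From Stdlib Require Import RelationClasses Relation_Operators.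
From mathcomp Require Import all_boot.
From mathcomp Require Import classical_sets cardinality.

Set Implicit Arguments.
Unset Strict Implicit.
Unset Printing Implicit Defensive.

Local Open Scope classical_set_scope.

Definition group (N : finType) : Type := {G : {set N} | G != finset.set0}.

Lemma set1_neq0 (N : finType) (i : N) : [set i]%SET != finset.set0.
Proof. by apply/finset.set0Pn; exists i; rewrite finset.in_set1. Qed.

Definition group1 (N : finType) (i : N) : group N :=
  exist (fun G : {set N} => G != finset.set0) [set i]%SET (set1_neq0 i).

Inductive form (N : finType) (Theta : Type) : Type :=
| Var (p : Theta)
| Neg (phi : form N Theta)
| And (phi psi : form N Theta)
| Coal (H : {set N}) (phi : form N Theta)
| Know (i : N) (phi : form N Theta)
| Common (G : group N) (phi : form N Theta)
| Dist (G : group N) (phi : form N Theta).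

Arguments Var {N Theta} p.

Section Abbreviations.
Variables (N : finType) (Theta : Type).
Implicit Types phi psi chi : form N Theta.

Definition Imp phi psi := Neg (And phi (Neg psi)).
Definition Iff phi psi := And (Imp phi psi) (Imp psi phi).

(* The language has no propositional constant: [Bot chi] is the contradiction
   built on an arbitrary formula [chi], and axioms mentioning it range over all
   [chi]. *)
Definition Bot chi := And chi (Neg chi).
Definition Top chi := Neg (Bot chi).

(* The conjunction of [f i] for [i] in [G]; the [nil] branch is unreachable
   because [G] is non-empty. *)
Definition Conj (G : group N) (f : N -> form N Theta) (dflt : form N Theta) :=
  match [seq f i | i <- enum (val G)] with
  | [::] => dflt
  | phi :: s => foldl (@And N Theta) phi s
  end.

Definition Everybody (G : group N) phi := Conj G (fun i => Know i phi) phi.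

(* A substitution instance of a propositional tautology: true under every
   assignment of truth values to formulas that respects [Neg] and [And], all
   other formulas being treated as atoms. *)
Definition tautology phi : Prop :=
  forall v : form N Theta -> bool,
    (forall a, v (Neg a) = ~~ v a) ->
    (forall a b, v (And a b) = v a && v b) ->
    v phi.

End Abbreviations.

Inductive derivable (N : finType) (Theta : Type) : form N Theta -> Prop :=
| ax_taut phi : tautology phi -> derivable phi
| ax_G1 G chi : derivable (Neg (Coal G (Bot chi)))
| ax_G2 G chi : derivable (Coal G (Top chi))
| ax_G3 phi :
    derivable (Imp (Neg (Coal finset.set0 (Neg phi))) (Coal [set: N]%SET phi))
| ax_G4 G phi psi : derivable (Imp (Coal G (And phi psi)) (Coal G psi))
| ax_G5 (G1 G2 : {set N}) phi psi : (G1 :&: G2)%SET = finset.set0 ->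
    derivable (Imp (And (Coal G1 phi) (Coal G2 psi))
                   (Coal (G1 :|: G2)%SET (And phi psi)))
| rule_MP phi psi : derivable phi -> derivable (Imp phi psi) -> derivable psi
| rule_RG G phi psi :
    derivable (Iff phi psi) -> derivable (Iff (Coal G phi) (Coal G psi))
| ax_KK i phi psi :
    derivable (Imp (Know i (Imp phi psi)) (Imp (Know i phi) (Know i psi)))
| ax_KT i phi : derivable (Imp (Know i phi) phi)
| ax_K4 i phi : derivable (Imp (Know i phi) (Know i (Know i phi)))
| ax_K5 i phi : derivable (Imp (Neg (Know i phi)) (Know i (Neg (Know i phi))))
| rule_RN i phi : derivable phi -> derivable (Know i phi)
  (* [Everybody] being an abbreviation, this has identical sides. *)
| ax_C1 G phi :
    derivable (Iff (Everybody G phi) (Conj G (fun i => Know i phi) phi))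
| ax_C2 G phi :
    derivable (Imp (Common G phi) (Everybody G (And phi (Common G phi))))
| rule_RC G phi psi :
    derivable (Imp phi (Everybody G (And phi psi))) ->
    derivable (Imp phi (Common G psi))
| ax_DK G phi psi :
    derivable (Imp (Dist G (Imp phi psi)) (Imp (Dist G phi) (Dist G psi)))
| ax_DT G phi : derivable (Imp (Dist G phi) phi)
| ax_D4 G phi : derivable (Imp (Dist G phi) (Dist G (Dist G phi)))
| ax_D5 G phi : derivable (Imp (Neg (Dist G phi)) (Dist G (Neg (Dist G phi))))
| ax_D1 i phi : derivable (Iff (Know i phi) (Dist (group1 i) phi))
| ax_Dmono (G H : group N) phi : val G \subset val H ->
    derivable (Imp (Dist G phi) (Dist H phi)).

Definition consistent (N : finType) (Theta : Type) (phi : form N Theta) : Prop :=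
  ~ derivable (Neg phi).

Definition minimal_elements (S : Type) (F : set (set S)) : set (set S) :=
  [set X | F X /\ forall Y, F Y -> Y `<=` X -> Y = X].

Record truly_playable (N : finType) (S : Type) (E : {set N} -> set (set S)) :
    Prop := TrulyPlayable {
  tp_E1 : forall G, ~ E G set0;
  tp_E2 : forall G, E G setT;
  tp_E3 : forall X, ~ E finset.set0 (~` X) -> E [set: N]%SET X;
  tp_E4 : forall G X Y, X `<=` Y -> E G X -> E G Y;
  tp_E5 : forall (G1 G2 : {set N}) X Y, (G1 :&: G2)%SET = finset.set0 ->
    E G1 X -> E G2 Y -> E (G1 :|: G2)%SET (X `&` Y);
  tp_E6 : minimal_elements (E finset.set0) !=set0
}.

Record pseudomodel (N : finType) (Theta : Type) : Type := Pseudomodel {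
  state : Type;
  sim : N -> state -> state -> Prop;
  drel : group N -> state -> state -> Prop;
  eff : {set N} -> state -> set (set state);
  valuation : Theta -> set state;
  state_nonempty : inhabited state;
  sim_equiv : forall i, Equivalence (sim i);
  drel_equiv : forall G, Equivalence (drel G);
  drel1 : forall i s t, drel (group1 i) s t <-> sim i s t;
  drel_mono : forall G H : group N, val G \subset val H ->
    forall s t, drel H s t -> drel G s t;
  eff_playable : forall s, truly_playable (fun G => eff G s)
}.

Definition finite_pseudomodel (N : finType) (Theta : Type)
    (M : pseudomodel N Theta) : Prop :=
  finite_set [set: state M].

Definition common_rel (N : finType) (Theta : Type) (M : pseudomodel N Theta)
    (G : group N) : state M -> state M -> Prop :=
  clos_refl_trans (state M) (fun s t => exists2 i, i \in val G & sim i s t).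

Fixpoint sat (N : finType) (Theta : Type) (M : pseudomodel N Theta)
    (s : state M) (phi : form N Theta) {struct phi} : Prop :=
  match phi with
  | Var p => valuation p s
  | Neg phi => ~ sat s phi
  | And phi psi => sat s phi /\ sat s psi
  | Coal H phi => eff H s [set t | sat t phi]
  | Know i phi => forall t, sim i s t -> sat t phi
  | Common G phi => forall t, common_rel G s t -> sat t phi
  | Dist G phi => forall t, drel G s t -> sat t phi
  end.

(* Main.v *)
(** Filtration of the canonical model through the subformulas of [phi]. Worlds
    are the truth vectors of maximal consistent sets on these subformulas, and
    each world [s] gets a chosen maximal consistent set [rep s]. Every set [X] of
    worlds is defined by a Boolean combination [form_of X] of subformulas, so
    [X] can be declared effective for [H] at [s] when [rep s] contains
    [[H] (form_of X)]: the axioms G1-G5 then give true playability, minimal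
    elements existing by finiteness.

    Call [a] [G]-stable when [a -> D_G a] is derivable, and relate two worlds by
    [R_G] when they agree on the [G]-stable subformulas. In S5 stability is closed
    under negation, so a refuted [D_G a] has a witness [R_G]-related to it. Each
    [C_G a] is [{i}]-stable for [i] in [G], and conversely the rule RC applied
    to [form_of] of the set of reachable worlds yields [C_G a]. *)

Require Import Defs.
From Stdlib Require Import RelationClasses Relation_Operators List.
From mathcomp Require Import all_boot.
From mathcomp Require Import boolp classical_sets cardinality.

Set Implicit Arguments.
Unset Strict Implicit.
Unset Printing Implicit Defensive.

Local Open Scope classical_set_scope.

(** * Derivability from hypotheses and Lindenbaum's lemma *)

Inductive prov (N : finType) (Theta : Type) (Gamma : set (form N Theta)) :
    form N Theta -> Prop :=
| prov_thm a : derivable a -> prov Gamma a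
| prov_hyp a : Gamma a -> prov Gamma a
| prov_MP a b : prov Gamma a -> prov Gamma (Imp a b) -> prov Gamma b.

(* Maximal consistent sets, as two-valued assignments to formulas. *)
Record mcs (N : finType) (Theta : Type) (v : form N Theta -> bool) : Prop := Mcs {
  mcs_neg : forall a, v (Neg a) = ~~ v a;
  mcs_and : forall a b, v (And a b) = v a && v b;
  mcs_thm : forall a, derivable a -> v a }.

Section Lindenbaum.
Variables (N : finType) (Theta : Type).
Implicit Types (a b c : form N Theta) (Gamma : set (form N Theta)).

Lemma derivable_taut a :
    (forall v : form N Theta -> bool,
      (forall b c, v (Imp b c) = (v b ==> v c)) ->
      (forall b, v (Neg b) = ~~ v b) ->
      (forall b c, v (And b c) = v b && v c) -> v a) ->
  derivable a.
Proof.
move=> va; apply: ax_taut => v vN vA; apply: va => // b c.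
by rewrite vN vA vN; case: (v b); case: (v c).
Qed.

Ltac prov_taut :=
  apply: prov_thm; apply: derivable_taut;
  let v := fresh in let vI := fresh in let vN := fresh in let vA := fresh in
  intros v vI vN vA; rewrite ?(vI, vN, vA);
  repeat (match goal with |- context [v ?x] => case: (v x) end).

Lemma prov_mono Gamma Delta a :
  Gamma `<=` Delta -> prov Gamma a -> prov Delta a.
Proof.
move=> GD; elim=> [b db|b Gb|b c _ IHb _ IHc]; first exact: prov_thm.
  exact/prov_hyp/GD.
exact: prov_MP IHb IHc.
Qed.

(** RG, RN and RC apply only to theorems inside [prov], so modus ponens is the only inductive
    case. *)
Lemma prov_deduction Gamma a b :
  prov (Gamma `|` [set a]) b -> prov Gamma (Imp a b).
Proof.
elim=> {b} [b db|b [Gb|->]|b c _ IHb _ IHc].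
- by apply: (prov_MP (prov_thm _ db)); prov_taut.
- by apply: (prov_MP (prov_hyp Gb)); prov_taut.
- by prov_taut.
- by apply: (prov_MP IHb); apply: (prov_MP IHc); prov_taut.
Qed.

(** A derivation uses finitely many hypotheses, and a chain has a member containing those it uses.
    The left alternative covers the empty chain. *)
Lemma prov_chain Gamma (F : set (set (form N Theta))) a :
    total_on F subset -> prov (Gamma `|` \bigcup_(X in F) X) a ->
  prov Gamma a \/ exists2 X, F X & prov (Gamma `|` X) a.
Proof.
move=> totF.
elim=> {a} [a da|a [Ga|[X FX Xa]]|a b _ IHa _ IHb].
- by left; exact: prov_thm.
- by left; exact: prov_hyp.
- by right; exists X => //; apply: prov_hyp; right.
case: IHa => [Ga|[X FX Xa]]; case: IHb => [Gb|[Y FY Yb]].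
- by left; exact: prov_MP Ga Gb.
- right; exists Y => //; apply: prov_MP Yb.
  by apply: prov_mono Ga => x; left.
- right; exists X => //; apply: prov_MP Xa _.
  by apply: prov_mono Gb => x; left.
- right; case: (totF X Y FX FY) => XY; [exists Y => //|exists X => //].
    by apply: prov_MP Yb; apply: prov_mono Xa; apply: setUS.
  by apply: (prov_MP Xa); apply: prov_mono Yb; apply: setUS.
Qed.

Lemma lindenbaum Gamma b : ~ prov Gamma b ->
  exists v, [/\ mcs v, forall a, Gamma a -> v a & ~~ v b].
Proof.
move=> nGb.
have [|D [/= nDb maxD]] :=
    @Zorn_bigcup _ [set D : set (form N Theta) | ~ prov (Gamma `|` D) b].
  by move=> F Fcons totF /= /(prov_chain totF) [//|[X /Fcons]].
(* By maximality, adding an unprovable [a] to [D] makes [b] provable; the deduction theorem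
   discharges [a]. *)
have out a : ~ prov (Gamma `|` D) a -> prov (Gamma `|` D) (Imp a b).
  move=> na; apply: prov_deduction; rewrite -setUA.
  apply: contrapT; apply: maxD; split; first by move=> x; left.
  by move=> /(_ a) DS; apply: na; apply: prov_hyp; right; apply: DS; right.
pose v a := `[< prov (Gamma `|` D) a >].
exists v; split; last 2 first.
- by move=> a Ga; apply/asboolP/prov_hyp; left.
- exact/asboolP.
split=> [a|a c|a da].
- rewrite /v -asbool_neg; apply: asbool_equiv_eq; split.
    move=> na a1; apply: nDb; apply: (prov_MP na); apply: (prov_MP a1).
    by prov_taut.
  move=> na; apply: contrapT => nna; apply: nDb.
  by apply: (prov_MP (out _ na)); apply: (prov_MP (out _ nna)); prov_taut.
- rewrite /v -asbool_and; apply: asbool_equiv_eq; split=> [ac|[a1 c1]].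
    by split; apply: (prov_MP ac); prov_taut.
  by apply: (prov_MP a1); apply: (prov_MP c1); prov_taut.
- by apply/asboolP/prov_thm.
Qed.

Lemma prov0 a : prov set0 a -> derivable a.
Proof. by elim=> // b c _ db _ dbc; exact: rule_MP db dbc. Qed.

Lemma mcs_complete a : (forall v, mcs v -> v a) -> derivable a.
Proof.
move=> va; apply: contrapT => na.
by have [/prov0//|v [/va -> _]] := @lindenbaum set0 a.
Qed.

End Lindenbaum.

(** * Modal reasoning inside maximal consistent sets *)

Section MaximalConsistentSets.
Variables (N : finType) (Theta : Type).
Implicit Types (a b c : form N Theta) (G : group N) (v : form N Theta -> bool).

Lemma mcs_imp v a b : mcs v -> v (Imp a b) = (v a ==> v b).
Proof.
by case=> vN vA _; rewrite vN vA vN; case: (v a); case: (v b).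
Qed.

Lemma mcs_iff v a b : mcs v -> v (Iff a b) = (v a == v b).
Proof.
by move=> mv; rewrite (mcs_and mv) !mcs_imp//; case: (v a); case: (v b).
Qed.

Lemma mcs_mp v a b : mcs v -> derivable (Imp a b) -> v a -> v b.
Proof. by move=> mv /(mcs_thm mv); rewrite mcs_imp// => /implyP. Qed.

Lemma mcs_Bot v a : mcs v -> v (Bot a) = false.
Proof. by move=> mv; rewrite (mcs_and mv) (mcs_neg mv) andbN. Qed.

Lemma mcs_Top v a : mcs v -> v (Top a).
Proof. by move=> mv; rewrite (mcs_neg mv) mcs_Bot. Qed.

Lemma mcs_foldl v a s : mcs v -> v (foldl (@And N Theta) a s) = v a && all v s.
Proof.
move=> mv; elim: s a => [|b s IHs] a /=; first by rewrite andbT.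
by rewrite IHs (mcs_and mv) andbA.
Qed.

Lemma mcs_Everybody v G a : mcs v ->
  v (Everybody G a) <-> forall i, i \in val G -> v (Know i a).
Proof.
move=> mv.
have -> : v (Everybody G a) = all (fun i => v (Know i a)) (enum (val G)).
  rewrite /Everybody /Conj -[all _ _]all_map.
  case def_s: (map _ _) => [|b s]; last exact: mcs_foldl.
  have [i iG] := finset.set0Pn _ (valP G).
  move/(congr1 size): def_s; rewrite size_map -cardE => /card0_eq/(_ i).
  by rewrite inE iG.
split=> [/allP vG i iG|vG]; first by apply: vG; rewrite mem_enum.
by apply/allP=> i; rewrite mem_enum => /vG.
Qed.

(** By completeness [a] is provably equivalent to [And a b]; RG replaces one by the other and G4
    drops the first conjunct. *)
Lemma coal_mono v H a b : mcs v -> (forall u, mcs u -> u a -> u b) ->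
  v (Coal H a) -> v (Coal H b).
Proof.
move=> mv ab va; apply: (mcs_mp mv (ax_G4 H a b)).
suff /(mcs_thm mv) : derivable (Iff (Coal H a) (Coal H (And a b))).
  by rewrite mcs_iff// va => /eqP <-.
apply/rule_RG/mcs_complete => u mu; rewrite mcs_iff// (mcs_and mu).
by case ua: (u a) => //=; rewrite (ab u).
Qed.

Lemma Know_Dist v i a : mcs v -> v (Know i a) = v (Dist (group1 i) a).
Proof.
by move=> mv; apply/eqP; rewrite -mcs_iff//; exact: mcs_thm (ax_D1 i a).
Qed.

(** Necessitation for [Know i] with [i] in [G] passes to the singleton group, then to [G] by
    monotonicity. *)
Lemma rule_DN G a : derivable a -> derivable (Dist G a).
Proof.
move=> da; apply: mcs_complete => v mv.
have [i iG] := finset.set0Pn _ (valP G).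
apply: (mcs_mp mv (@ax_Dmono _ _ (group1 i) G a _)).
  by rewrite finset.sub1set.
by rewrite -Know_Dist//; apply: mcs_thm => //; apply: rule_RN.
Qed.

Lemma Dist_imp v G a b : mcs v -> derivable (Imp a b) ->
  v (Dist G a) -> v (Dist G b).
Proof.
move=> mv /(rule_DN G)/(mcs_thm mv)/(mcs_mp mv (ax_DK _ _ _)).
by rewrite mcs_imp// => /implyP.
Qed.

Definition stable G a := derivable (Imp a (Dist G a)).

(** From [Neg a], axiom T gives [Neg (Dist G a)], axiom 5 puts [Dist G] in front, and contraposed
    stability turns the inner formula back into [Neg a]. *)
Lemma stable_neg G a : stable G a -> stable G (Neg a).
Proof.
move=> sa; apply: mcs_complete => v mv; rewrite mcs_imp//; apply/implyP=> va.
apply: (@Dist_imp _ _ (Neg (Dist G a))) => //.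
  apply: mcs_complete => u mu; rewrite mcs_imp// !(mcs_neg mu).
  by apply/implyP; apply: contra => /(mcs_mp mu sa).
apply: (mcs_mp mv (ax_D5 _ _)); move: va; rewrite !(mcs_neg mv).
by apply: contra; apply: (mcs_mp mv (ax_DT _ _)).
Qed.

Lemma stable_Dist G a : stable G (Dist G a).
Proof. exact: ax_D4. Qed.

Lemma stable_Know i a : stable (group1 i) (Know i a).
Proof.
apply: mcs_complete => v mv; rewrite mcs_imp// -Know_Dist//.
by rewrite -mcs_imp//; apply: mcs_thm => //; exact: ax_K4.
Qed.

Lemma Common_Know v G i a : mcs v -> i \in val G ->
  v (Common G a) -> v (Know i (And a (Common G a))).
Proof. by move=> mv iG /(mcs_mp mv (ax_C2 _ _))/mcs_Everybody; apply. Qed.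

Lemma stable_Common G i a : i \in val G -> stable (group1 i) (Common G a).
Proof.
move=> iG; apply: mcs_complete => v mv; rewrite mcs_imp//; apply/implyP.
move/(Common_Know mv iG); rewrite Know_Dist//; apply: Dist_imp => //.
apply: mcs_complete => u mu; rewrite mcs_imp// (mcs_and mu).
by apply/implyP=> /andP[].
Qed.

Lemma stable_mono (G H : group N) a :
  val G \subset val H -> stable G a -> stable H a.
Proof.
move=> GH sa; apply: mcs_complete => v mv; rewrite mcs_imp//; apply/implyP.
by move/(mcs_mp mv sa)/(mcs_mp mv (ax_Dmono a GH)).
Qed.

(** Lindenbaum extends the formulas [a] with [v (Dist G a)] while refuting [b]. Stable formulas thus
    pass from [v] to [u], and their negations do too, which gives equality. *)
Lemma Dist_witness v G b : mcs v -> ~~ v (Dist G b) ->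
  exists u, [/\ mcs u, ~~ u b & forall a, stable G a -> u a = v a].
Proof.
move=> mv nb; have [|u [mu Du nub]] := @lindenbaum _ _ [set a | v (Dist G a)] b.
  move=> Db; move/negP: nb; apply; elim: Db => {b} [a da|//|a b _ va _].
    by apply: mcs_thm => //; exact: rule_DN.
  by move/(mcs_mp mv (ax_DK _ _ _)); rewrite mcs_imp// va.
have up a : stable G a -> v a -> u a by move=> sa /(mcs_mp mv sa)/Du.
exists u; split=> // a sa; case va: (v a); first exact: up.
apply/negbTE; rewrite -(mcs_neg mu); apply: up; first exact: stable_neg.
by rewrite (mcs_neg mv) va.
Qed.

End MaximalConsistentSets.

(** * Subformulas, worlds and definability of sets of worlds *)

Fixpoint sub (N : finType) (Theta : Type) (a : form N Theta) : seq (form N Theta) :=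
  a :: match a with
       | Var _ => [::]
       | And b c => sub b ++ sub c
       | Neg b | Coal _ b | Know _ b | Common _ b | Dist _ b => sub b
       end.

Section Filtration.
Variables (N : finType) (Theta : Type) (phi : form N Theta).
Implicit Types (a b c : form N Theta) (G : group N) (v : form N Theta -> bool).

Let L := sub phi.

Definition vec v : (size L).-tuple bool := map_tuple v (in_tuple L).

Lemma vec_eq u v a : vec u = vec v -> In a L -> u a = v a.
Proof.
move/(congr1 val) => /=; elim: L => //= b s IHs [ub /IHs us] [<-//|/us//].
Qed.

Definition world := {w : (size L).-tuple bool | `[< exists2 v, mcs v & vec v = w >]}.

Definition cls v (mv : mcs v) : world :=
  exist _ (vec v) (asboolT (ex_intro2 _ _ v mv erefl)).

Definition rep (s : world) : form N Theta -> bool := s2val (cid2 (asboolW (valP s))).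

Lemma rep_mcs s : mcs (rep s).
Proof. exact: (s2valP (cid2 (asboolW (valP s)))). Qed.

Lemma vec_rep s : vec (rep s) = val s.
Proof. exact: (s2valP' (cid2 (asboolW (valP s)))). Qed.

Lemma cls_rep s : cls (rep_mcs s) = s.
Proof. by apply: val_inj; rewrite /= vec_rep. Qed.

Lemma rep_cls v (mv : mcs v) a : In a L -> rep (cls mv) a = v a.
Proof. by apply: vec_eq; rewrite vec_rep. Qed.

(* Boole expansion of the truth function [P] over the formulas in [s]. *)
Fixpoint boole (s : seq (form N Theta)) (P : seq bool -> bool) : form N Theta :=
  if s is a :: s' then
    Neg (And (Neg (And a (boole s' (fun w => P (true :: w)))))
             (Neg (And (Neg a) (boole s' (fun w => P (false :: w))))))
  else if P [::] then Top phi else Bot phi.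

Lemma mcs_boole v s P : mcs v -> v (boole s P) = P (map v s).
Proof.
move=> mv; elim: s P => [|a s IHs] P /=.
  by case: ifP => _; rewrite ?mcs_Top ?mcs_Bot.
rewrite !(mcs_neg mv, mcs_and mv) !IHs.
by case: (v a); rewrite /= ?andbT ?negbK.
Qed.

Definition form_of (X : set world) : form N Theta :=
  boole L (fun w => `[< exists2 s, X s & val s = w :> seq bool >]).

(** Being valid in every maximal consistent set, not only in the representatives, this yields
    derivable formulas by [mcs_complete] and feeds [coal_mono]. *)
Lemma mcs_form_of v (mv : mcs v) X : v (form_of X) <-> X (cls mv).
Proof.
rewrite mcs_boole//; split=> [/asboolP[s Xs sv]|Xv].
  by have -> : cls mv = s by do 2![apply: val_inj].
by apply/asboolP; exists (cls mv).
Qed.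

(** * The effectivity function and true playability *)

Definition feff (H : {set N}) (s : world) : set (set world) :=
  [set X | rep s (Coal H (form_of X))].

Lemma feff_sub H s X Y : X `<=` Y -> feff H s X -> feff H s Y.
Proof.
move=> XY; apply: coal_mono; first exact: rep_mcs.
by move=> u mu /(mcs_form_of mu)/XY/(mcs_form_of mu).
Qed.

Lemma feff_playable s : truly_playable (fun H => feff H s).
Proof.
have ms := rep_mcs s.
have effT H : feff H s setT.
  have := mcs_thm ms (ax_G2 H phi).
  by apply: coal_mono => // u mu _; apply/(mcs_form_of mu).
split=> [H sH|//|X sX|H X Y|G1 G2 X Y G12 sX sY|].
- have := mcs_thm ms (ax_G1 H phi); rewrite (mcs_neg ms) => /negP; apply.
  by apply: coal_mono sH => // u mu /(mcs_form_of mu).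
- apply: (mcs_mp ms (ax_G3 _)); rewrite (mcs_neg ms).
  apply/negP => sX'; apply: sX; apply: coal_mono sX' => // u mu.
  rewrite (mcs_neg mu) => /negP uX; apply/(mcs_form_of mu) => Xu.
  exact/uX/(mcs_form_of mu).
- exact: feff_sub.
- have : rep s (And (Coal G1 (form_of X)) (Coal G2 (form_of Y))).
    by rewrite (mcs_and ms); apply/andP.
  move/(mcs_mp ms (ax_G5 _ _ G12)); apply: coal_mono => // u mu.
  rewrite (mcs_and mu) => /andP[/(mcs_form_of mu) Xu /(mcs_form_of mu) Yu].
  exact/(mcs_form_of mu).
- have [|A /minsetP[/asboolP sA minA]] :=
    @ex_minset world (fun A => `[< feff finset.set0 s [set` A] >]).
    exists [set: world]%SET; apply/asboolP; apply: feff_sub (effT _) => t _ /=.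
    by rewrite finset.in_setT.
  exists [set` A]; split=> // Y sY YA.
  (* Minimality of [A] is known only among finite sets, so the competitor [Y] is first encoded as
     one. *)
  have [B YE] : exists B : {set world}, Y = [set` B].
    exists [set t | `[< Y t >]]%SET; apply/seteqP.
    by split=> t /=; rewrite finset.in_set => /asboolP.
  rewrite YE in sY YA *; rewrite (minA B) //; first exact/asboolP.
  by apply/fintype.subsetP=> t /YA.
Qed.

(** * Accessibility relations and the truth lemma *)

Definition fdrel G (s t : world) : Prop :=
  forall a, In a L -> stable G a -> rep s a = rep t a.

Lemma fdrel_equiv G : Equivalence (fdrel G).
Proof.
split=> [s a//|s t st a La sa|s t r st tr a La sa]; first by rewrite st.
by rewrite st// tr.
Qed.

Lemma fdrel_mono (G H : group N) : val G \subset val H ->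
  forall s t, fdrel H s t -> fdrel G s t.
Proof. by move=> GH s t st a La sa; apply: st => //; apply: stable_mono sa. Qed.

Definition filtration (s0 : world) : pseudomodel N Theta :=
  @Pseudomodel N Theta world (fun i => fdrel (group1 i)) fdrel feff
    (fun p => [set s | rep s (Var p)])
    (inhabits s0) (fun i => fdrel_equiv (group1 i)) fdrel_equiv
    (fun i s t => iff_refl _) fdrel_mono feff_playable.

Lemma truth s0 b : incl (sub b) L ->
  forall s : state (filtration s0), sat s b <-> rep s b.
Proof.
(* Here [v] need not be a chosen representative: [fdrel] inspects only formulas of [L], on which
   [rep (cls mv)] agrees with [v]. *)
have wit v (mv : mcs v) G a : ~~ v (Dist G a) ->
    exists u (mu : mcs u), ~~ u a /\ fdrel G (cls mv) (cls mu).
  move=> /(Dist_witness mv)[u [mu ua uv]]; exists u, mu; split=> // c Lc sc.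
  by rewrite !rep_cls// uv.
elim: b => [p|b IHb|b IHb c IHc|H b IHb|i b IHb|G b IHb|G b IHb] sL s //=.
- have Lb : incl (sub b) L by move=> x xb; apply: sL; right.
  rewrite (mcs_neg (rep_mcs s)) IHb//; split=> [/negP//|/negP//].
- have Lb : incl (sub b) L by move=> x xb; apply: sL; right; apply/in_or_app; left.
  have Lc : incl (sub c) L by move=> x xb; apply: sL; right; apply/in_or_app; right.
  by rewrite (mcs_and (rep_mcs s)) IHb// IHc//; split=> /andP.
all: have Lb : incl (sub b) L by move=> x xb; apply: sL; right.
all: have Lbb : In b L by apply: Lb; case: (b) => *; left.
all: have := sL _ (or_introl erefl); move: (IHb Lb) => {}IHb Lx.
(* The formula defining the extension of [b] is equivalent to [b] in every maximal consistent set,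
   so [Coal H] cannot separate them. *)
- have bE u : mcs u -> u (form_of [set t | sat (t : state (filtration s0)) b]) = u b.
    move=> mu; apply/idP/idP.
      by move=> /(mcs_form_of mu) /IHb; rewrite rep_cls.
    by move=> ub; apply/(mcs_form_of mu)/IHb; rewrite rep_cls.
  by split; apply: coal_mono; try exact: rep_mcs; move=> u mu; rewrite bE.
- split=> [sb|sb t st].
    apply: contrapT => /negP; rewrite Know_Dist; last exact: rep_mcs.
    case/(wit _ (rep_mcs s)) => u [mu [/negP ub]]; rewrite cls_rep => /sb/IHb.
    by rewrite rep_cls.
  apply/IHb/(mcs_mp (rep_mcs t) (ax_KT i b)).
  by rewrite -(st _ Lx (stable_Know _ _)).
- split=> [sb|sb t st].
    pose X := [set t | common_rel G (s : state (filtration s0)) t].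
    (* This is the premise of RC: [X] is closed under the relations of agents in [G], and [b] holds
       throughout it. *)
    have dX : derivable (Imp (form_of X) (Everybody G (And (form_of X) b))).
      apply: mcs_complete => v mv; rewrite mcs_imp//; apply/implyP.
      move/(mcs_form_of mv) => Xv; apply/mcs_Everybody => // i iG.
      apply: contrapT => /negP; rewrite Know_Dist// => /(wit _ mv)[u [mu []]].
      rewrite (mcs_and mu) => /negP nu vu; apply: nu.
      have Xu : X (cls mu).
        by apply: rt_trans Xv _; apply: rt_step; exists i.
      apply/andP; split; first exact/(mcs_form_of mu).
      by rewrite -(rep_cls mu)//; apply/IHb/sb.
    apply: (mcs_mp (rep_mcs s) (rule_RC dX)).
    by apply/(mcs_form_of (rep_mcs s)); rewrite cls_rep; exact: rt_refl.
  (* [Common G b] is stable for each agent of [G], so it is carried along the path from [s] to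
     [t]. *)
  have : rep t (Common G b).
    elim: st sb => // [x y [i iG xy]|x y z _ IHxy _ IHyz /IHxy/IHyz//].
    by rewrite (xy _ Lx (stable_Common _ iG)).
  have [i iG] := finset.set0Pn _ (valP G).
  move/(Common_Know (rep_mcs t) iG)/(mcs_mp (rep_mcs t) (ax_KT _ _)).
  by rewrite (mcs_and (rep_mcs t)) => /andP[/IHb].
- split=> [sb|sb t st].
    apply: contrapT => /negP.
    case/(wit _ (rep_mcs s)) => u [mu [/negP ub]]; rewrite cls_rep => /sb/IHb.
    by rewrite rep_cls.
  apply/IHb/(mcs_mp (rep_mcs t) (ax_DT G b)).
  by rewrite -(st _ Lx (stable_Dist _ _)).
Qed.

End Filtration.

Theorem theorem4 (N : finType) (Theta : Type) (phi : form N Theta) :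
  consistent phi ->
  exists M : pseudomodel N Theta,
    finite_pseudomodel M /\ exists s : state M, sat s phi.
Proof.
move=> cons_phi.
(* Consistency says that [Neg phi] is unprovable, so some maximal consistent set refutes it; its
   class is the satisfying world. *)
have [/prov0//|v [mv _]] := @lindenbaum _ _ set0 (Neg phi).
rewrite (mcs_neg mv) negbK => vphi.
exists (filtration (cls phi mv)); split; first exact: finite_finset.
exists (cls phi mv); apply/truth; first exact: incl_refl.
by rewrite rep_cls//; case: (phi) => *; left.
Qed.
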